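(* Let $R_2$ be the $(n+2)$-dimensional solvable Leibniz algebra over a field $\mathbb{K}$ with basis $\{e_1,\dots,e_n,x,y\}$ (where $n\ge 3$, so that $e_3$ exists) and multiplication $$[e_1,e_1]=e_3,\qquad [e_i,e_1]=e_{i+1}\ (3\le i\le n-1),\qquad [e_1,x]=-[x,e_1]=e_1,$$ $$[e_i,x]=(i-1)e_i\ (3\le i\le n),\qquad [e_2,y]=-[y,e_2]=e_2,$$ all other products of basis elements being zero. Then every local automorphism of $R_2$ is an automorphism of $R_2$.
   Context: A Leibniz algebra over a field $\mathbb{K}$ is an algebra $L$ over $\mathbb{K}$ with bilinear multiplication $[-,-]$ satisfying $[[x,y],z]=[[x,z],y]+[x,[y,z]]$ for all $x,y,z\in L$. It is solvable if $L^{(s)}=0$ for some $s\in\mathbb{N}$, where $L^{(1)}=L$ and $L^{(k+1)}=[L^{(k)},L^{(k)}]$. An automorphism of an algebra $A$ is a bijective linear map $\varphi:A\to A$ with $\varphi([u,v])=[\varphi(u),\varphi(v)]$ for all $u,v\in A$. A linear map $\Phi:A\to A$ is called a local automorphism if for every $u\in A$ there exists an automorphism $\varphi_u:A\to A$ (depending on $u$) such that $\Phi(u)=\varphi_u(u)$. *)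

(* Defs.v *)
From HB Require Import structures.
From mathcomp Require Import all_boot all_order all_algebra.
From mathcomp Require Import zify.

Set Implicit Arguments.
Unset Strict Implicit.
Unset Printing Implicit Defensive.

Import GRing.Theory.
Local Open Scope ring_scope.

(* An algebra is a finite-dimensional vector space L together with a bilinear
   bracket br : {bilinear L -> L -> L}. *)

Definition leibniz_algebra (K : fieldType) (L : vectType K) (br : L -> L -> L) :=
  forall x y z : L, br (br x y) z = br (br x z) y + br x (br y z).

Definition bracket_space (K : fieldType) (L : vectType K) (br : L -> L -> L)
    (U V : {vspace L}) : {vspace L} :=
  <<[seq br u v | u <- vbasis U, v <- vbasis V]>>%VS.

(* [derived_series br k] is $L^{(k+1)}$: the usual numbering starts at 1. *)
Fixpoint derived_series (K : fieldType) (L : vectType K) (br : L -> L -> L)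
    (k : nat) : {vspace L} :=
  if k is k'.+1 then
    bracket_space br (derived_series br k') (derived_series br k')
  else fullv.

Definition solvable_algebra (K : fieldType) (L : vectType K)
    (br : L -> L -> L) :=
  exists s : nat, derived_series br s = 0%VS.

Definition automorphism (K : fieldType) (L : vectType K) (br : L -> L -> L)
    (phi : L -> L) :=
  [/\ linear phi, bijective phi
    & forall u v : L, phi (br u v) = br (phi u) (phi v)].

Definition local_automorphism (K : fieldType) (L : vectType K)
    (br : L -> L -> L) (Phi : L -> L) :=
  linear Phi /\
  forall u : L, exists phi : L -> L, automorphism br phi /\ Phi u = phi u.

(* [is_R2 br n e x y]: (L, br) is the algebra $R_2$ with respect to the basis
   e 1, ..., e n, x, y.  The values of e outside 1..n are irrelevant.  The
   fields from R2_ee0 on spell out "all other products vanish". *)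
Record is_R2 (K : fieldType) (L : vectType K) (br : L -> L -> L) (n : nat)
    (e : nat -> L) (x y : L) : Prop := IsR2 {
  R2_basis : basis_of fullv ([seq e i | i <- iota 1 n] ++ [:: x; y]);
  R2_e1e1 : br (e 1%N) (e 1%N) = e 3%N;
  R2_eie1 : forall i, (3 <= i <= n.-1)%N -> br (e i) (e 1%N) = e i.+1;
  R2_e1x : br (e 1%N) x = e 1%N;
  R2_xe1 : br x (e 1%N) = - e 1%N;
  R2_eix : forall i, (3 <= i <= n)%N -> br (e i) x = i.-1%:R *: e i;
  R2_e2y : br (e 2%N) y = e 2%N;
  R2_ye2 : br y (e 2%N) = - e 2%N;
  R2_ee0 : forall i j, (1 <= i <= n)%N -> (2 <= j <= n)%N ->
             br (e i) (e j) = 0;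
  R2_e2e1 : br (e 2%N) (e 1%N) = 0;
  R2_ene1 : br (e n) (e 1%N) = 0;
  R2_e2x : br (e 2%N) x = 0;
  R2_xe0 : forall i, (2 <= i <= n)%N -> br x (e i) = 0;
  R2_ey0 : forall i, (1 <= i <= n)%N -> i != 2%N -> br (e i) y = 0;
  R2_ye0 : forall i, (1 <= i <= n)%N -> i != 2%N -> br y (e i) = 0;
  R2_xx : br x x = 0;
  R2_xy : br x y = 0;
  R2_yx : br y x = 0;
  R2_yy : br y y = 0
}.

(* Sanity checks: such an algebra is a solvable Leibniz algebra, and it exists
   over every field. *)

Lemma span_induction (K : fieldType) (L : vectType K) (X : seq L)
    (P : L -> Prop) :
  P 0 -> (forall a u v, P u -> P v -> P (a *: u + v)) ->
  {in X, forall u, P u} -> forall v, v \in <<X>>%VS -> P v.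
Proof.
move=> P0 PD PX v vX; rewrite (coord_span (X := in_tuple X) vX).
elim/big_rec: _ => // i w _ Pw; apply: PD => //.
by apply: PX; apply: mem_nth.
Qed.

Lemma bracket_space_sub (K : fieldType) (L : vectType K)
    (br : {bilinear L -> L -> L}) (U W : {vspace L}) (X : seq L) :
  (U <= <<X>>)%VS -> {in X &, forall u v, br u v \in W} ->
  (bracket_space br U U <= W)%VS.
Proof.
move=> UX XW; apply/span_subvP => w /allpairsP[[u v] /= [uU vU ->]].
move: {uU vU}(vbasis_mem uU) (vbasis_mem vU) => uU vU.
move: {uU vU}(subvP UX _ uU) (subvP UX _ vU) => uX vX.
move: u uX v vX.
apply: span_induction => [v _|a u u' IHu IHu' v vX|u uX].
- by rewrite linear0l mem0v.
- by rewrite linearPl memvD ?memvZ ?IHu ?IHu'.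
apply: span_induction => [|a v v' IHv IHv'|v vX]; last exact: XW.
- by rewrite linear0r mem0v.
- by rewrite linearPr memvD ?memvZ.
Qed.

Section R2.
Variables (K : fieldType) (L : vectType K) (br : {bilinear L -> L -> L}).
Variables (n : nat) (e : nat -> L) (x y : L).
Hypotheses (n_ge3 : (3 <= n)%N) (H : is_R2 br n e x y).

Let F k : L := if (k.+3 <= n)%N then e k.+3 else 0.


Let basisP u : u \in [seq e i | i <- iota 1 n] ++ [:: x; y] ->
  [\/ u = e 1%N, u = e 2%N, exists k, u = F k | u = x \/ u = y].
Proof.
rewrite mem_cat !inE => /orP[/mapP[i i_n ->]|/orP[]/eqP->]; last first.
- by constructor 4; right.
- by constructor 4; left.
case: i i_n => [|[|[|k]]]; rewrite mem_iota // => kn.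
- by constructor 1.
- by constructor 2.
by constructor 3; exists k; rewrite /F ifT //; lia.
Qed.

Let F_l k v : ((k.+3 <= n)%N -> br (e k.+3) v = 0) -> br (F k) v = 0.
Proof. by rewrite /F; case: ifP => [_ ->|]; rewrite ?linear0l. Qed.

Let F_r k v : ((k.+3 <= n)%N -> br v (e k.+3) = 0) -> br v (F k) = 0.
Proof. by rewrite /F; case: ifP => [_ ->|]; rewrite ?linear0r. Qed.

Let e1e1 : br (e 1%N) (e 1%N) = F 0.
Proof. by rewrite (R2_e1e1 H) /F n_ge3. Qed.

Let Fe1 k : br (F k) (e 1%N) = F k.+1.
Proof.
rewrite /F; case: (ltngtP k.+3 n) => kn; last by rewrite kn (R2_ene1 H).
- by rewrite (R2_eie1 H) //; lia.
- by rewrite linear0l.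
Qed.

Let Fx k : br (F k) x = k.+2%:R *: F k.
Proof.
rewrite /F; case: ifP => kn; last by rewrite linear0l scaler0.
by rewrite (R2_eix H) //; lia.
Qed.

Let Fy k : br (F k) y = 0.
Proof. by apply: F_l => kn; rewrite (R2_ey0 H) //; lia. Qed.

Let Fe2 k : br (F k) (e 2%N) = 0.
Proof. by apply: F_l => kn; rewrite (R2_ee0 H) //; lia. Qed.

Let FF k l : br (F k) (F l) = 0.
Proof. by apply: F_l => kn; apply: F_r => ln; rewrite (R2_ee0 H) //; lia. Qed.

Let e1F k : br (e 1%N) (F k) = 0.
Proof. by apply: F_r => kn; rewrite (R2_ee0 H) //; lia. Qed.

Let e2F k : br (e 2%N) (F k) = 0.
Proof. by apply: F_r => kn; rewrite (R2_ee0 H) //; lia. Qed.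

Let xF k : br x (F k) = 0.
Proof. by apply: F_r => kn; rewrite (R2_xe0 H) //; lia. Qed.

Let yF k : br y (F k) = 0.
Proof. by apply: F_r => kn; rewrite (R2_ye0 H) //; lia. Qed.

Let e1e2 : br (e 1%N) (e 2%N) = 0.
Proof. by rewrite (R2_ee0 H) //; lia. Qed.

Let e2e2 : br (e 2%N) (e 2%N) = 0.
Proof. by rewrite (R2_ee0 H) //; lia. Qed.

Let xe2 : br x (e 2%N) = 0.
Proof. by rewrite (R2_xe0 H) //; lia. Qed.

Let e1y : br (e 1%N) y = 0.
Proof. by rewrite (R2_ey0 H) //; lia. Qed.

Let ye1 : br y (e 1%N) = 0.
Proof. by rewrite (R2_ye0 H) //; lia. Qed.

Let tab := (e1e1, Fe1, Fx, Fy, Fe2, FF, e1F, e2F, xF, yF, e1e2, e2e2, xe2, e1y,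
  ye1, (R2_e1x H, R2_xe1 H, R2_e2y H, R2_ye2 H, R2_e2e1 H, R2_e2x H, R2_xx H,
  R2_xy H, R2_yx H, R2_yy H)).

Let lin := (linear0l, linear0r, linearNl, linearNr, linearZl_LR, linearZr_LR).

Let R2_ind (P : L -> Prop) :
  P 0 -> (forall a u v, P u -> P v -> P (a *: u + v)) ->
  P (e 1%N) -> P (e 2%N) -> (forall k, P (F k)) -> P x -> P y ->
  forall v, P v.
Proof.
move=> P0 PD P1 P2 PF Px Py v; have := memvf v.
rewrite -(span_basis (R2_basis H)); apply: span_induction => //.
by move=> u /basisP[->|->|[k ->]|[]->].
Qed.

Lemma R2_leibniz : leibniz_algebra br.
Proof.
move=> u v w; move: u v w.
elim/R2_ind => [v w|a u u' IH IH' v w|||k||]; first by rewrite !lin !addr0.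
  by rewrite !linearPl IH IH' scalerDr addrACA.
all: elim/R2_ind => [w|a v v' IH IH' w|||l||];
  try by rewrite !lin ?addr0.
all: try by rewrite !(linearPr, linearPl) IH IH' scalerDr addrACA.
all: elim/R2_ind => [|a w w' IH IH'|||m||]; try by rewrite !lin ?addr0.
all: try by rewrite !(linearPr, linearPl) IH IH' scalerDr addrACA.
all: rewrite !(tab, lin) ?oppr0 ?scaler0 ?addr0 ?add0r ?opprK ?addNr ?subrr //.
all: by rewrite ?scaler_nat ?mulr2n ?[_ *+ _.+3]mulrSr ?addrK.
Qed.

Lemma R2_solvable : solvable_algebra br.
Proof.
pose X1 := e 1%N :: e 2%N :: [seq e i | i <- iota 3 (n - 2)].
pose X2 := [seq e i | i <- iota 3 (n - 2)].
have X2F k : F k \in <<X2>>%VS.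
  rewrite /F; case: ifP => kn; last exact: mem0v.
  by apply/memv_span/map_f; rewrite mem_iota; lia.
have X2P u : u \in X2 -> exists k, u = F k.
  case/mapP=> i; rewrite mem_iota => hi ->; exists (i - 3)%N.
  by rewrite /F ifT; [congr e; lia|lia].
have X2X1 v : v \in <<X2>>%VS -> v \in <<X1>>%VS.
  by apply/subvP/sub_span => u; rewrite !inE => ->; rewrite !orbT.
have X1_1 : e 1%N \in <<X1>>%VS by rewrite memv_span ?mem_head.
have X1_2 : e 2%N \in <<X1>>%VS by rewrite memv_span // !inE eqxx orbT.
exists 3; apply/eqP; rewrite -subv0 /=.
apply: (@bracket_space_sub _ _ _ _ _ X2); last first.
  by move=> _ _ /X2P[k ->] /X2P[l ->]; rewrite FF mem0v.
apply: (@bracket_space_sub _ _ _ _ _ X1); last first.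
  move=> u v; rewrite !inE => /or3P[/eqP->|/eqP->|/X2P[k ->]];
  by move=> /or3P[/eqP->|/eqP->|/X2P[l ->]]; rewrite !tab ?mem0v ?X2F.
apply: (bracket_space_sub (X := [seq e i | i <- iota 1 n] ++ [:: x; y])).
  by rewrite (span_basis (R2_basis H)).
move=> u v /basisP[->|->|[k ->]|[]->] /basisP[->|->|[l ->]|[]->];
  by rewrite !tab ?memvN ?memvZ ?mem0v //; apply: X2X1; rewrite ?memvZ.
Qed.

End R2.

Lemma R2_exists (K : fieldType) (n : nat) : (3 <= n)%N ->
  exists (L : vectType K) (br : {bilinear L -> L -> L}) (e : nat -> L)
    (x y : L), is_R2 br n e x y.
Proof.
move=> n_ge3.
pose E k : 'rV[K]_n.+2 := delta_mx 0 (inord k).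
pose t (i j : nat) : 'rV[K]_n.+2 :=
  if j == 0 then
    if i == 0 then E 2 else if (2 <= i < n.-1)%N then E i.+1 else
    if i == n then - E 0 else 0
  else if j == 1 then if i == n.+1 then - E 1 else 0
  else if j == n then
    if i == 0 then E 0 else if (2 <= i < n)%N then i%:R *: E i else 0
  else if j == n.+1 then if i == 1 then E 1 else 0 else 0.
pose f (u v : 'rV[K]_n.+2) :=
  \sum_(i < n.+2) \sum_(j < n.+2) (u 0 i * v 0 j) *: t i j.
have fP : bilinear_for *:%R *:%R f.
  split=> w a u v; rewrite /f /= scaler_sumr -big_split /=; apply: eq_bigr => i _;
    rewrite scaler_sumr -big_split /=; apply: eq_bigr => j _;
    rewrite !mxE scalerA -scalerDl; congr (_ *: _).
    by rewrite mulrDl mulrA.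
  by rewrite mulrDr mulrCA.
pose fM := bilinear_isBilinear.Build K _ _ _ _ _ f fP.
pose br : {bilinear 'rV[K]_n.+2 -> 'rV[K]_n.+2 -> 'rV[K]_n.+2} :=
  HB.pack f fM.
have brE k l : (k < n.+2)%N -> (l < n.+2)%N -> br (E k) (E l) = t k l.
  move=> kn ln; rewrite /= /f (bigD1 (inord k)) //= (bigD1 (inord l)) //=.
  rewrite !mxE !eqxx mulr1 scale1r !inordK //.
  rewrite big1 => [|j /negPf jl]; last by rewrite !mxE jl mulr0 scale0r.
  rewrite addr0 big1 ?addr0 // => i /negPf ik; rewrite big1 // => j _.
  by rewrite !mxE ik mul0r scale0r.
exists ('rV[K]_n.+2 : vectType K), br, (fun i => E i.-1), (E n), (E n.+1).
have br' k l w : (k < n.+2)%N -> (l < n.+2)%N -> t k l = w ->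
  br (E k) (E l) = w by move=> kn ln <-; exact: brE.
split.
- have -> : [seq E i.-1 | i <- iota 1 n] ++ [:: E n; E n.+1]
      = [seq E i | i <- iota 0 n.+2].
    have -> : iota 0 n.+2 = iota 0 n ++ [:: n; n.+1].
      by have := iotaD 0 n 2; rewrite addn2.
    rewrite map_cat; congr (_ ++ _).
    by rewrite (iotaDl 1 0) -map_comp; apply: eq_map => i.
  rewrite basisEdim size_map size_iota dimvf [dim _]mul1n leqnn andbT.
  apply/subvP => v _; rewrite [v]row_sum_delta; apply: memv_suml => j _.
  have -> : delta_mx 0 j = E j by rewrite /E inord_val.
  by apply/memvZ/memv_span/map_f; rewrite mem_iota /=.
all: move=> *; apply: br'; try lia; rewrite /t.
all: repeat (case: ifP; try lia) => //.
by move=> _ _; congr E; lia.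
Qed.

(* Main.v *)
(** With f_0 = e_1 and f_m = e_(m+2) for m >= 1, R_2 is the direct sum of the
ideals <f_0, f_1, ..., x> and <e_2, y>, where right multiplication by f_0 shifts
f_m to f_(m+1), and right multiplication by x scales f_m by m+1.  An automorphism
phi maps e_2 into <e_2> and y into y + <e_2, e_n>, and on the first summand it is
determined by phi x and the f_0-coordinate of phi f_0, the coordinates k_m of
phi x satisfying (m+1) k_m = - k_0 k_(m-1).  So either m != 0 in K for
0 < m < n, and k_0 determines phi x, or k_0 = 0 for every automorphism, and then
phi respects the weights of f_m and x modulo the characteristic.

Dividing a local automorphism Phi by automorphisms, one may assume that it fixes
x, and then f_0.  Testing Phi on a few sums of x, f_0 and f_m shows that it then
fixes every f_m; the second summand puts no further constraint on Phi. *)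
From HB Require Import structures.
Require Import Defs.
From mathcomp Require Import all_boot all_order all_algebra.
From mathcomp Require Import zify ring.
Set Implicit Arguments.
Unset Strict Implicit.
Unset Printing Implicit Defensive.
Import GRing.Theory.
Local Open Scope ring_scope.

(** * Automorphisms and local automorphisms of an arbitrary algebra *)

Lemma inj_linear_bij (K : fieldType) (L : vectType K) (g : {linear L -> L}) :
  injective g -> bijective g.
Proof.
move=> g_inj; have ker0 : lker (linfun g) == 0%VS.
  by apply/lker0P => u v; rewrite !lfunE => /g_inj.
exists (linfun g)^-1%VF => u; first by rewrite -[g u]lfunE lker0_lfunK.
by rewrite -[g _]lfunE lker0_lfunVK.
Qed.

Section Automorphisms.
Variables (K : fieldType) (L : vectType K) (br : L -> L -> L).

Lemma linear_pack (phi : L -> L) : linear phi ->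
  exists g : {linear L -> L}, phi = g :> (L -> L).
Proof.
move=> phi_lin; pose gM := GRing.isLinear.Build K L L _ phi phi_lin.
by pose g : {linear L -> L} := HB.pack phi gM; exists g.
Qed.

Lemma automorphism_pack phi : automorphism br phi ->
  exists g : {linear L -> L},
    [/\ injective g, {morph g : u v / br u v} & phi = g :> (L -> L)].
Proof.
case=> /linear_pack[g ->] g_bij gM; exists g; split=> //.
exact: bij_inj g_bij.
Qed.

Lemma inj_morph_automorphism (g : {linear L -> L}) :
  injective g -> {morph g : u v / br u v} -> automorphism br g.
Proof.
move=> g_inj gM; split=> //; first exact: linearP.
exact: inj_linear_bij.
Qed.

Lemma automorphism_inv phi : automorphism br phi ->
  exists psi, [/\ automorphism br psi, cancel phi psi & cancel psi phi].
Proof.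
case=> phi_lin [psi phiK psiK] phiM; exists psi; split=> //; split.
- by move=> a u v; apply: (can_inj phiK); rewrite phi_lin !psiK.
- by exists phi.
- by move=> u v; apply: (can_inj phiK); rewrite phiM !psiK.
Qed.

Lemma automorphism_comp psi phi : automorphism br psi -> automorphism br phi ->
  automorphism br (psi \o phi).
Proof.
move=> [psi_lin psi_bij psiM] [phi_lin phi_bij phiM]; split.
- by move=> a u v; rewrite /= phi_lin psi_lin.
- exact: bij_comp.
- by move=> u v; rewrite /= phiM psiM.
Qed.

(** At [u - v] the map agrees with an automorphism, which kills only 0. *)
Lemma local_automorphism_inj Phi : local_automorphism br Phi -> injective Phi.
Proof.
case=> /linear_pack[g ->] g_loc u v guv; apply/eqP; rewrite -subr_eq0; apply/eqP.
have [phi [/automorphism_pack[h [h_inj _ ->]] E]] := g_loc (u - v).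
by apply: h_inj; rewrite -E linearB guv subrr linear0.
Qed.

(** [Psi] is the inverse of [phi] composed with [Phi]. The last clause carries multiplicativity
    back, so a local automorphism can be normalized one vector at a time. *)
Lemma local_automorphism_div Phi phi : local_automorphism br Phi ->
  automorphism br phi ->
  exists Psi : {linear L -> L},
    [/\ local_automorphism br Psi, forall u, phi (Psi u) = Phi u &
        {morph Psi : u v / br u v} -> {morph Phi : u v / br u v}].
Proof.
move=> [Phi_lin Phi_loc] phi_aut.
have [psi [psi_aut phiK psiK]] := automorphism_inv phi_aut.
have /linear_pack[Psi PsiE] : linear (psi \o Phi).
  by case: psi_aut => psi_lin _ _ a u v; rewrite /= Phi_lin psi_lin.
have PsiK u : phi (Psi u) = Phi u by rewrite -PsiE /= psiK.
exists Psi; split=> //.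
  split=> [|u]; first exact: linearP.
  have [chi [chi_aut E]] := Phi_loc u.
  exists (psi \o chi); split; first exact: automorphism_comp.
  by rewrite -PsiE /= E.
by case: phi_aut => _ _ phiM PsiM u v; rewrite -!PsiK PsiM phiM.
Qed.

End Automorphisms.

(** * The multiplication table of R_2 along the chain *)

Section R2Structure.
Variables (K : fieldType) (n : nat) (L : vectType K) (br : {bilinear L -> L -> L}).
Variables (e : nat -> L) (x y : L).
Hypotheses (n_ge3 : (3 <= n)%N) (R2 : is_R2 br n e x y).

(* e_1, e_3, e_4, ..., e_n, 0, 0, ... *)
Definition chain m : L :=
  if m is k.+1 then if (k.+3 <= n)%N then e k.+3 else 0 else e 1%N.
Local Notation f := chain.

Lemma chain_out m : (n <= m.+1)%N -> f m = 0.
Proof. by case: m => [|m] /= h; [lia | case: ifP => //; lia]. Qed.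

Lemma basis_chainP u : u \in [seq e i | i <- iota 1 n] ++ [:: x; y] ->
  [\/ exists m, u = f m, u = e 2%N, u = x | u = y].
Proof.
rewrite mem_cat !inE => /orP[/mapP[i i_n ->]|/orP[]/eqP->]; last first.
- by constructor 4.
- by constructor 3.
case: i i_n => [|[|[|k]]]; rewrite mem_iota // => kn.
- by constructor 1; exists 0.
- by constructor 2.
by constructor 1; exists k.+1; rewrite /= ifT //; lia.
Qed.

Lemma R2_ind (P : L -> Prop) :
  P 0 -> (forall a u v, P u -> P v -> P (a *: u + v)) ->
  (forall m, P (f m)) -> P (e 2%N) -> P x -> P y -> forall v, P v.
Proof.
move=> P0 PD Pf P2 Px Py v; have := memvf v.
rewrite -(span_basis (R2_basis R2)); apply: span_induction => //.
by move=> u /basis_chainP[[m ->]|->|->|->].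
Qed.

(** Since the chain continues with zeros after e_n, the rule [e_n, e_1] = 0 is one more shift, and
    no bound on [m] is needed. *)
Lemma br_chain0 m : br (f m) (f 0) = f m.+1.
Proof.
case: m => [|m] /=; first by rewrite (R2_e1e1 R2) n_ge3.
case: (ltngtP m.+3 n) => mn; last by rewrite mn (R2_ene1 R2).
- by rewrite (R2_eie1 R2) //; lia.
- by rewrite linear0l.
Qed.

Lemma br_chainS m k : br (f m) (f k.+1) = 0.
Proof.
rewrite /=; case: ifP => kn; rewrite ?linear0r //.
case: m => [|m] /=; first by rewrite (R2_ee0 R2) //; lia.
by case: ifP => mn; rewrite ?linear0l // (R2_ee0 R2) //; lia.
Qed.

Lemma br_chainx m : br (f m) x = m.+1%:R *: f m.
Proof.
case: m => [|m] /=; first by rewrite (R2_e1x R2) scale1r.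
by case: ifP => mn; rewrite ?linear0l ?scaler0 // (R2_eix R2) //; lia.
Qed.

Lemma br_xchain0 : br x (f 0) = - f 0.
Proof. exact: R2_xe1 R2. Qed.

Lemma br_xchainS m : br x (f m.+1) = 0.
Proof. by rewrite /=; case: ifP => mn; rewrite ?linear0r // (R2_xe0 R2) //; lia. Qed.

Lemma br_chainy m : br (f m) y = 0.
Proof.
case: m => [|m] /=; first by rewrite (R2_ey0 R2) //; lia.
by case: ifP => mn; rewrite ?linear0l // (R2_ey0 R2) //; lia.
Qed.

Lemma br_ychain m : br y (f m) = 0.
Proof.
case: m => [|m] /=; first by rewrite (R2_ye0 R2) //; lia.
by case: ifP => mn; rewrite ?linear0r // (R2_ye0 R2) //; lia.
Qed.

Lemma br_chaine2 m : br (f m) (e 2%N) = 0.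
Proof.
case: m => [|m] /=; first by rewrite (R2_ee0 R2) //; lia.
by case: ifP => mn; rewrite ?linear0l // (R2_ee0 R2) //; lia.
Qed.

Lemma br_e2chain m : br (e 2%N) (f m) = 0.
Proof.
case: m => [|m] /=; first by rewrite (R2_e2e1 R2).
by case: ifP => mn; rewrite ?linear0r // (R2_ee0 R2) //; lia.
Qed.

Arguments chain : simpl never.

Lemma br_e2e2 : br (e 2%N) (e 2%N) = 0.
Proof. by rewrite (R2_ee0 R2) //; lia. Qed.

Lemma br_xe2 : br x (e 2%N) = 0.
Proof. by rewrite (R2_xe0 R2) //; lia. Qed.

Let tab := (br_chain0, br_chainS, br_chainx, br_xchain0, br_xchainS, br_chainy,
  br_ychain, br_chaine2, br_e2chain, br_e2e2, br_xe2, (R2_e2y R2, R2_ye2 R2,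
  R2_e2x R2, R2_xx R2, R2_xy R2, R2_yx R2, R2_yy R2)).

Let lin := (linear0l, linear0r, linearNl, linearNr, linearZl_LR, linearZr_LR).

(** * Coordinates with respect to the basis *)

Definition basisR2 : n.+2.-tuple L :=
  tcast (addn2 n) [tuple of [tuple e (i : 'I_n).+1 | i < n] ++ [tuple x; y]].

Lemma basisR2E : basisR2 = [seq e i | i <- iota 1 n] ++ [:: x; y] :> seq L.
Proof.
rewrite /basisR2 val_tcast /= (iotaDl 1 0) -map_comp -val_enum_ord -map_comp.
by congr (_ ++ _).
Qed.

Let B_basis : basis_of fullv basisR2.
Proof. by rewrite basisR2E; exact: R2_basis R2. Qed.

Definition cbas i (u : L) : K := coord basisR2 (inord i) u.
(* [bump 1] skips [e 2], the second basis vector. *)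
Definition cf m (u : L) : K := if (m.+1 < n)%N then cbas (bump 1 m) u else 0.
Definition c2 := cbas 1.
Definition cx := cbas n.
Definition cy := cbas n.+1.

Let cbas_nth i j : (i < n.+2)%N -> (j < n.+2)%N ->
  cbas i (basisR2`_j) = (i == j)%:R.
Proof.
move=> i_n j_n; have := coord_free (inord j) (inord i) (basis_free B_basis).
by rewrite -val_eqE /= !inordK // eq_sym.
Qed.

Let nth_e j : (0 < j <= n)%N -> e j = basisR2`_j.-1.
Proof.
move=> j_n; rewrite basisR2E nth_cat size_map size_iota ifT; last by lia.
by rewrite (nth_map 0) ?size_iota ?nth_iota; [congr e|..]; lia.
Qed.

Let nth_x : x = basisR2`_n.
Proof. by rewrite basisR2E nth_cat size_map size_iota ltnn subnn. Qed.

Let nth_y : y = basisR2`_n.+1.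
Proof. by rewrite basisR2E nth_cat size_map size_iota ltnNge leqnSn subSnn. Qed.

Let nth_f m : f m = if (m.+1 < n)%N then basisR2`_(bump 1 m) else 0.
Proof.
case: m => [|m]; first by rewrite ifT ?[f 0]nth_e //; lia.
by rewrite /chain; case: ifP => // mn; rewrite nth_e // /bump add1n.
Qed.

Lemma cbas_linear i a u v : cbas i (a *: u + v) = a * cbas i u + cbas i v.
Proof. by rewrite /cbas linearP. Qed.

Lemma cf_linear m a u v : cf m (a *: u + v) = a * cf m u + cf m v.
Proof. by rewrite /cf; case: ifP; rewrite ?cbas_linear // mulr0 addr0. Qed.

HB.instance Definition _ i := GRing.isLinear.Build K L K *%R (cbas i)
  (cbas_linear i).
HB.instance Definition _ m := GRing.isLinear.Build K L K *%R (cf m)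
  (cf_linear m).
HB.instance Definition _ := GRing.Linear.on c2.
HB.instance Definition _ := GRing.Linear.on cx.
HB.instance Definition _ := GRing.Linear.on cy.

Lemma cf_f m j : (m.+1 < n)%N -> cf m (f j) = (m == j)%:R.
Proof.
move=> mn; rewrite nth_f /cf mn; case: ifP => jn; last first.
  by rewrite linear0; case: eqP => // mj; lia.
rewrite cbas_nth /bump; try lia.
by congr _%:R; lia.
Qed.

Lemma cf_e2 m : cf m (e 2%N) = 0.
Proof.
rewrite nth_e /cf; last by lia.
case: ifP => // mn; rewrite cbas_nth /bump; try lia.
by case: eqP => //; lia.
Qed.

Lemma cf_x m : cf m x = 0.
Proof.
rewrite nth_x /cf; case: ifP => // mn; rewrite cbas_nth /bump; try lia.
by case: eqP => //; lia.
Qed.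

Lemma cf_y m : cf m y = 0.
Proof.
rewrite nth_y /cf; case: ifP => // mn; rewrite cbas_nth /bump; try lia.
by case: eqP => //; lia.
Qed.

Lemma cf_out m u : (n <= m.+1)%N -> cf m u = 0.
Proof. by rewrite /cf ltnNge => ->. Qed.

Let cbas_f i m : (i < n.+2)%N -> (i == 1%N) || (n <= i)%N -> cbas i (f m) = 0.
Proof.
move=> i_n hi; rewrite nth_f; case: ifP => mn; last by rewrite linear0.
rewrite cbas_nth /bump; try lia.
by case: eqP => //; lia.
Qed.

Lemma c2_f m : c2 (f m) = 0. Proof. by apply: cbas_f; lia. Qed.
Lemma cx_f m : cx (f m) = 0. Proof. by apply: cbas_f; lia. Qed.
Lemma cy_f m : cy (f m) = 0. Proof. by apply: cbas_f; lia. Qed.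

Lemma c2_e2 : c2 (e 2%N) = 1.
Proof. by rewrite nth_e /c2 ?cbas_nth //; lia. Qed.
Lemma cx_e2 : cx (e 2%N) = 0.
Proof. by rewrite nth_e /cx ?cbas_nth; try lia; case: eqP => //; lia. Qed.
Lemma cy_e2 : cy (e 2%N) = 0.
Proof. by rewrite nth_e /cy ?cbas_nth; try lia; case: eqP => //; lia. Qed.
Lemma c2_x : c2 x = 0.
Proof. by rewrite nth_x /c2 cbas_nth; try lia; case: eqP => //; lia. Qed.
Lemma cx_x : cx x = 1.
Proof. by rewrite nth_x /cx cbas_nth ?eqxx //; lia. Qed.
Lemma cy_x : cy x = 0.
Proof. by rewrite nth_x /cy cbas_nth; try lia; case: eqP => //; lia. Qed.
Lemma c2_y : c2 y = 0.
Proof. by rewrite nth_y /c2 cbas_nth; try lia; case: eqP => //; lia. Qed.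
Lemma cx_y : cx y = 0.
Proof. by rewrite nth_y /cx cbas_nth; try lia; case: eqP => //; lia. Qed.
Lemma cy_y : cy y = 1.
Proof. by rewrite nth_y /cy cbas_nth ?eqxx //; lia. Qed.

Definition c_basis := (cf_e2, cf_x, cf_y, c2_f, cx_f, cy_f, c2_e2, cx_e2, cy_e2,
  (c2_x, cx_x, cy_x, c2_y, cx_y, cy_y)).

Lemma coord_ext u v : (forall m, (m.+1 < n)%N -> cf m u = cf m v) ->
  c2 u = c2 v -> cx u = cx v -> cy u = cy v -> u = v.
Proof.
move=> uvf uv2 uvx uvy.
rewrite (coord_basis B_basis (memvf u)) (coord_basis B_basis (memvf v)).
apply: eq_bigr => i _; congr (_ *: _).
suff: cbas i u = cbas i v by rewrite /cbas inord_val.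
case: i => i /= i_n.
have [->|i1] := eqVneq i 1%N; first exact: uv2.
have [->|i2] := eqVneq i n; first exact: uvx.
have [->|i3] := eqVneq i n.+1; first exact: uvy.
have mn : ((unbump 1 i).+1 < n)%N by rewrite /unbump; lia.
by have := uvf _ mn; rewrite /cf mn unbumpKcond (negPf i1).
Qed.

(** * Coordinates of a bracket *)

Lemma cx_br u v : cx (br u v) = 0.
Proof.
move: u v; elim/R2_ind => [v|a u u' IH IH' v|m|||]; first by rewrite !lin linear0.
  by rewrite linearPl linearP /= IH IH' mulr0 addr0.
all: elim/R2_ind => [|a v v' IH IH'|k|||]; first by rewrite !lin linear0.
all: try by rewrite linearPr linearP /= IH IH' mulr0 addr0.
all: try case: k => [|k].
all: by rewrite !tab ?linearN ?linearZ ?linear0 /= ?c_basis ?mulr0 ?oppr0.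
Qed.

Lemma cy_br u v : cy (br u v) = 0.
Proof.
move: u v; elim/R2_ind => [v|a u u' IH IH' v|m|||]; first by rewrite !lin linear0.
  by rewrite linearPl linearP /= IH IH' mulr0 addr0.
all: elim/R2_ind => [|a v v' IH IH'|k|||]; first by rewrite !lin linear0.
all: try by rewrite linearPr linearP /= IH IH' mulr0 addr0.
all: try case: k => [|k].
all: by rewrite !tab ?linearN ?linearZ ?linear0 /= ?c_basis ?mulr0 ?oppr0.
Qed.

(** The ideal <e_2, y> is the nonabelian Lie algebra of dimension 2, whence the determinant. *)
Lemma c2_br u v : c2 (br u v) = c2 u * cy v - cy u * c2 v.
Proof.
move: u v; elim/R2_ind => [v|a u u' IH IH' v|m|||].
- by rewrite !lin !linear0; ring.
- by rewrite linearPl !linearP /= IH IH'; ring.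
all: elim/R2_ind => [|a v v' IH IH'|k|||]; first by rewrite !lin !linear0; ring.
all: try by rewrite linearPr !linearP /= IH IH'; ring.
all: try case: k => [|k].
all: by rewrite !tab ?linearN ?linearZ ?linear0 /= ?c_basis; ring.
Qed.

(** Modulo f_1, f_2, ... the first summand is again the nonabelian Lie algebra of dimension 2, now
    on f_0 and [x]. *)
Lemma cf0_br u v : cf 0 (br u v) = cf 0 u * cx v - cx u * cf 0 v.
Proof.
move: u v; elim/R2_ind => [v|a u u' IH IH' v|m|||].
- by rewrite !lin !linear0; ring.
- by rewrite linearPl !linearP /= IH IH'; ring.
all: elim/R2_ind => [|a v v' IH IH'|k|||]; first by rewrite !lin !linear0; ring.
all: try by rewrite linearPr !linearP /= IH IH'; ring.
all: try case: k => [|k].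
all: try case: m => [|m].
all: rewrite !tab ?linearN ?linearZ ?linear0 /= ?c_basis ?cf_f //=; by [ring|lia].
Qed.

(** f_(m+1) arises only as the shift [f_m, f_0] and, with weight m + 2, from [f_(m+1), x]. *)
Lemma cfS_br m u v : (m.+2 < n)%N ->
  cf m.+1 (br u v) = cf m u * cf 0 v + m.+2%:R * cf m.+1 u * cx v.
Proof.
move=> mn; move: u v; elim/R2_ind => [v|a u u' IH IH' v|l|||].
- by rewrite !lin !linear0; ring.
- by rewrite linearPl !linearP /= IH IH'; ring.
all: elim/R2_ind => [|a v v' IH IH'|k|||]; first by rewrite !lin !linear0; ring.
all: try by rewrite linearPr !linearP /= IH IH'; ring.
all: try case: k => [|k].
all: rewrite !tab ?linearN ?linearZ ?linear0 /= ?c_basis ?cf_f ?eqSS ?mulr0 ?mulr1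
  ?mul0r ?addr0 ?add0r ?oppr0 //; try lia.
by case: eqP => [<-|]; rewrite ?mulr1 ?mulr0.
Qed.

(** * Automorphisms of R_2 *)

Section Automorphism.
Variable phi : {linear L -> L}.
Hypotheses (phi_inj : injective phi)
  (phiM : {morph phi : u v / br u v}).

Lemma chain_neq0 m : (m.+1 < n)%N -> f m != 0.
Proof.
by move=> mn; apply/eqP => /(congr1 (cf m))/eqP; rewrite cf_f // eqxx linear0 oner_eq0.
Qed.

Let phi_neq0 u : u != 0 -> phi u != 0.
Proof. by apply: contra_neq => u0; apply: phi_inj; rewrite u0 linear0. Qed.

Let n1 : (1 < n)%N. Proof. by lia. Qed.

Let phi_e2_br : phi (e 2%N) = br (phi (e 2%N)) (phi y).
Proof. by rewrite -phiM !tab. Qed.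

Let phi_f0_br : phi (f 0) = br (phi (f 0)) (phi x).
Proof. by rewrite -phiM !tab scale1r. Qed.

Let cx_phi_e2 : cx (phi (e 2%N)) = 0. Proof. by rewrite phi_e2_br cx_br. Qed.
Let cy_phi_e2 : cy (phi (e 2%N)) = 0. Proof. by rewrite phi_e2_br cy_br. Qed.
Let cx_phi_f0 : cx (phi (f 0)) = 0. Proof. by rewrite phi_f0_br cx_br. Qed.
Let cy_phi_f0 : cy (phi (f 0)) = 0. Proof. by rewrite phi_f0_br cy_br. Qed.

Let cf0_phi_e2 : cf 0 (phi (e 2%N)) = 0.
Proof.
(* As [phi (e 2)] has no [x]-coordinate, the f_1-coordinate of its square is the square of its
   f_0-coordinate. *)
have : cf 1 (phi (br (e 2%N) (e 2%N))) = 0 by rewrite !tab !linear0.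
rewrite phiM cfS_br // cx_phi_e2 mulr0 addr0 => /eqP.
by rewrite mulf_eq0 orbb => /eqP.
Qed.

(** Right multiplication by [phi (e 2)] yields no f_m with m > 0, because its f_0- and
    [x]-coordinates vanish; and [y, e_2] = - e_2 makes [phi (e 2)] such a product up to sign. *)
Let cf_phi_e2 m : (m.+1 < n)%N -> cf m (phi (e 2%N)) = 0.
Proof.
case: m => // m mn; have : cf m.+1 (phi (br y (e 2%N))) = 0.
  by rewrite phiM cfS_br // cf0_phi_e2 cx_phi_e2 !mulr0 addr0.
by rewrite !tab !linearN /= => /eqP; rewrite oppr_eq0 => /eqP.
Qed.

Lemma aut_e2 : phi (e 2%N) = c2 (phi (e 2%N)) *: e 2%N.
Proof.
apply: coord_ext => [m mn|||]; rewrite linearZ /= c_basis ?mulr0 ?mulr1 //.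
exact: cf_phi_e2.
Qed.

Lemma aut_c2_e2_neq0 : c2 (phi (e 2%N)) != 0.
Proof.
have : phi (e 2%N) != 0.
  apply/phi_neq0/eqP => /(congr1 c2)/eqP.
  by rewrite linear0 c_basis oner_eq0.
by apply: contra_neq => h; rewrite aut_e2 h scale0r.
Qed.

Let cy_phi_y : cy (phi y) = 1.
Proof.
have := congr1 c2 phi_e2_br; rewrite c2_br cy_phi_e2 mul0r subr0.
rewrite -{1}[c2 _]mulr1 => h.
by rewrite (mulfI aut_c2_e2_neq0 h).
Qed.

Lemma aut_cy_x : cy (phi x) = 0.
Proof.
have : c2 (phi (br (e 2%N) x)) = 0 by rewrite !tab !linear0.
rewrite phiM c2_br cy_phi_e2 mul0r subr0 => /eqP.
by rewrite mulf_eq0 (negPf aut_c2_e2_neq0) => /eqP.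
Qed.

Lemma aut_c2_f0 : c2 (phi (f 0)) = 0.
Proof. by rewrite phi_f0_br c2_br aut_cy_x cy_phi_f0; ring. Qed.

(** Otherwise [phi (f 0)] would square to 0, but its square is [phi (f 1)], which is nonzero as n >=
    3. *)
Lemma aut_cf0_neq0 : cf 0 (phi (f 0)) != 0.
Proof.
have : phi (f 1) != 0 by apply/phi_neq0/chain_neq0.
apply: contra_neq => h; rewrite -br_chain0 phiM; apply: coord_ext => [[|m] mn|||].
- by rewrite cf0_br h cx_phi_f0 linear0; ring.
- by rewrite cfS_br // h cx_phi_f0 linear0; ring.
- by rewrite c2_br cy_phi_f0 linear0; ring.
- by rewrite cx_br linear0.
- by rewrite cy_br linear0.
Qed.

Lemma aut_cx_x : cx (phi x) = 1.
Proof.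
have := congr1 (cf 0) phi_f0_br; rewrite cf0_br cx_phi_f0 mul0r subr0.
by rewrite -{1}[cf 0 _]mulr1 => /(mulfI aut_cf0_neq0) <-.
Qed.

Lemma aut_c2_x : c2 (phi x) = 0.
Proof.
have : c2 (phi (br x y)) = 0 by rewrite !tab !linear0.
by rewrite phiM c2_br aut_cy_x cy_phi_y mul0r subr0 mulr1.
Qed.

(** Read off from [x, f_0] = - f_0. *)
Lemma aut_f0S m : (m.+2 < n)%N ->
  cf m.+1 (phi (f 0)) = - (cf 0 (phi (f 0)) * cf m (phi x)).
Proof.
move=> mn; have : cf m.+1 (phi (br x (f 0))) = - cf m.+1 (phi (f 0)).
  by rewrite !tab !linearN.
rewrite phiM cfS_br // cx_phi_f0 mulr0 addr0 => h.
by rewrite mulrC h opprK.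
Qed.

(** Read off from [x, x] = 0; this is the recursion for the coordinates k_m. *)
Lemma aut_xS m : (m.+2 < n)%N ->
  m.+2%:R * cf m.+1 (phi x) = - (cf 0 (phi x) * cf m (phi x)).
Proof.
move=> mn; have : cf m.+1 (phi (br x x)) = 0 by rewrite !tab !linear0.
rewrite phiM cfS_br // aut_cx_x mulr1 => /eqP; rewrite addrC addr_eq0 => /eqP ->.
by rewrite mulrC.
Qed.

(** Here [f k.+1] is e_n. The [x]-coordinate vanishes by [f_0, y] = 0, every f_m-coordinate except
    the last by [y, f_0] = 0, and [y, x] = 0 lets the last one survive only if n - 1 = 0 in K. *)
Lemma aut_y k : n = k.+3 ->
  phi y = y + c2 (phi y) *: e 2%N + cf k.+1 (phi y) *: f k.+1 /\
  k.+2%:R * cf k.+1 (phi y) = 0.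
Proof.
move=> nk.
have cx0 : cx (phi y) = 0.
  have : cf 0 (phi (br (f 0) y)) = 0 by rewrite !tab !linear0.
  rewrite phiM cf0_br cx_phi_f0 mul0r subr0 => /eqP.
  by rewrite mulf_eq0 (negPf aut_cf0_neq0) => /eqP.
have cfm0 m : (m.+2 < n)%N -> cf m (phi y) = 0.
  move=> mn; have : cf m.+1 (phi (br y (f 0))) = 0 by rewrite !tab !linear0.
  rewrite phiM cfS_br // cx_phi_f0 mulr0 addr0 => /eqP.
  by rewrite mulf_eq0 (negPf aut_cf0_neq0) orbF => /eqP.
split; last first.
  have : cf k.+1 (phi (br y x)) = 0 by rewrite !tab !linear0.
  by rewrite phiM cfS_br ?aut_cx_x ?(cfm0 k) ?mul0r ?add0r ?mulr1 //; lia.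
apply: coord_ext => [m mn|||].
- rewrite !linearD !linearZ /= !c_basis cf_f // !(add0r, mulr0).
  case: eqP => [->|h]; first by rewrite mulr1.
  by rewrite mulr0 cfm0 //; lia.
- by rewrite !linearD !linearZ /= !c_basis; ring.
- by rewrite !linearD !linearZ /= !c_basis cx0; ring.
- by rewrite !linearD !linearZ /= !c_basis cy_phi_y; ring.
Qed.

Lemma aut_cf0_fS m : cf 0 (phi (f m.+1)) = 0.
Proof.
rewrite -br_chain0 phiM cf0_br cx_phi_f0 mulr0 sub0r.
case: m => [|m]; first by rewrite cx_phi_f0 mul0r oppr0.
by rewrite -br_chain0 phiM cx_br mul0r oppr0.
Qed.

Lemma aut_cfS_fS j m : (j.+2 < n)%N ->
  cf j.+1 (phi (f m.+1)) = cf 0 (phi (f 0)) * cf j (phi (f m)).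
Proof.
by move=> jn; rewrite -br_chain0 phiM cfS_br // cx_phi_f0 mulr0 addr0 mulrC.
Qed.

Lemma aut_coord_f m :
  [/\ c2 (phi (f m)) = 0, cx (phi (f m)) = 0 & cy (phi (f m)) = 0].
Proof.
case: m => [|m]; first by rewrite aut_c2_f0.
rewrite -br_chain0 phiM c2_br cx_br cy_br cy_phi_f0 mulr0 sub0r.
by rewrite aut_c2_f0 mulr0 oppr0.
Qed.

(** By the recursion [aut_xS], k_0 != 0 makes every product (m+1) k_m nonzero, hence both of its
    factors. *)
Lemma aut_char m : cf 0 (phi x) != 0 -> (m.+1 < n)%N -> m.+1%:R != 0 :> K.
Proof.
move=> s0 mn; suff: m.+1%:R * cf m (phi x) != 0.
  by rewrite mulf_eq0 negb_or => /andP[].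
elim: m mn => [|m IH] mn; first by rewrite mul1r.
have := IH (ltnW mn); rewrite mulf_eq0 negb_or => /andP[_ km].
by rewrite aut_xS // oppr_eq0 mulf_neq0.
Qed.

(** For k_0 = 0 the recursion becomes (m+1) k_m = 0: [phi x] stays in weight 0 modulo the
    characteristic. *)
Lemma aut_x_weight m : cf 0 (phi x) = 0 -> cf m (phi x) != 0 ->
  m.+1%:R = 0 :> K.
Proof.
move=> s0; case: (ltnP m.+1 n) => [mn|/cf_out ->]; last by rewrite eqxx.
case: m mn => [|m] mn; first by rewrite s0 eqxx.
have /eqP := aut_xS mn; rewrite s0 mul0r oppr0 mulf_eq0.
by move=> /orP[/eqP|/eqP ->] //; rewrite eqxx.
Qed.

(** For f_0 this follows from [aut_f0S] and the weights of [phi x]; bracketing with [phi (f 0)] then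
    shifts both indices by one. *)
Lemma aut_f_weight j m : cf 0 (phi x) = 0 -> cf j (phi (f m)) != 0 ->
  j%:R = m%:R :> K.
Proof.
move=> s0; elim: m j => [|m IH] [|j] //.
- case: (ltnP j.+2 n) => [jn|/cf_out ->]; last by rewrite eqxx.
  rewrite aut_f0S // oppr_eq0 mulf_eq0 negb_or => /andP[_].
  by move/(aut_x_weight s0) => ->.
- by rewrite aut_cf0_fS eqxx.
- case: (ltnP j.+2 n) => [jn|/cf_out ->]; last by rewrite eqxx.
  rewrite aut_cfS_fS // mulf_eq0 negb_or => /andP[_ /IH h].
  by rewrite ![_.+1%:R]mulrS h.
Qed.

Lemma aut_x_id : (forall m, (m.+1 < n)%N -> cf m (phi x) = 0) -> phi x = x.
Proof.
move=> h; apply: coord_ext => [m mn|||]; rewrite ?c_basis.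
- exact: h.
- exact: aut_c2_x.
- exact: aut_cx_x.
- exact: aut_cy_x.
Qed.

Lemma aut_x_id_char :
  (forall m, (m.+1 < n)%N -> m.+1%:R != 0 :> K) ->
  cf 0 (phi x) = 0 -> phi x = x.
Proof.
move=> charK s0; apply: aut_x_id => m mn; apply/eqP; apply: contraTT (charK m mn).
by move=> /(aut_x_weight s0)/eqP; rewrite negbK.
Qed.

(** When all k_m vanish, [phi (f 0)] is a multiple of f_0, and f_m is a product of m + 1 copies of
    f_0. *)
Lemma aut_f_scale m : phi x = x ->
  phi (f m) = cf 0 (phi (f 0)) ^+ m.+1 *: f m.
Proof.
move=> phix; elim: m => [|m IH].
  have [? ? ?] := aut_coord_f 0.
  apply: coord_ext => [[|m] mn|||]; rewrite ?linearZ /= ?c_basis ?mulr0 //.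
    by rewrite expr1 cf_f // mulr1.
  by rewrite aut_f0S // phix c_basis cf_f // !mulr0 oppr0.
have [? ? ?] := aut_coord_f m.+1.
apply: coord_ext => [[|j] jn|||]; rewrite ?linearZ /= ?c_basis ?mulr0 //.
  by rewrite aut_cf0_fS cf_f // mulr0.
rewrite aut_cfS_fS // IH linearZ /= !cf_f ?eqSS; try lia.
by rewrite [_ ^+ m.+2]exprS mulrA.
Qed.

Lemma aut_f_id m : phi (f 0) = f 0 -> phi (f m) = f m.
Proof.
by move=> phi0; elim: m => // m IH; rewrite -br_chain0 phiM IH phi0.
Qed.

End Automorphism.

(** * Local automorphisms of R_2 *)

Section LocalAutomorphism.
Variable Phi : {linear L -> L}.
Hypothesis Phi_aut : local_automorphism br Phi.

Let Phi_local u : exists phi : {linear L -> L},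
  [/\ injective phi, {morph phi : u v / br u v} & Phi u = phi u].
Proof.
have [phi [/automorphism_pack[g [g_inj gM ->]] E]] := Phi_aut.2 u.
by exists g.
Qed.

(** Only the images of e_2 and [y] remain open. The shapes imposed by [aut_e2] and [aut_y], applied
    separately at these two vectors, already respect the multiplication table. *)
Lemma local_morph_fix : Phi x = x -> (forall m, Phi (f m) = f m) ->
  {morph Phi : u v / br u v}.
Proof.
move=> Px Pf.
have [b P2] : exists b, Phi (e 2%N) = b *: e 2%N.
  by have [phi [phi_inj phiM ->]] := Phi_local (e 2%N); eexists; exact: aut_e2.
have [k nk] : exists k, n = k.+3 by exists (n - 3)%N; lia.
have [t [g [Py g0]]] : exists t g,
    Phi y = y + t *: e 2%N + g *: f k.+1 /\ k.+2%:R * g = 0.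
  have [phi [phi_inj phiM ->]] := Phi_local y.
  by have := aut_y phi_inj phiM nk; do 2 eexists; eassumption.
have fk : f k.+2 = 0 by apply: chain_out; rewrite nk.
elim/R2_ind => [v|a u u' IH IH' v|l|||].
- by rewrite !(linear0, linear0l).
- by rewrite linearPl !linearP /= IH IH' linearPl.
all: elim/R2_ind => [|a v v' IH IH'|j|||];
  first by rewrite !(linear0, linear0r).
all: try by rewrite linearPr [LHS]linearP IH IH' [Phi (_ + _)]linearP linearPr.
all: try case: j => [|j].
all: rewrite ?Px ?Pf ?P2 ?Py !(linearDl, linearDr, tab, lin) ?linear0
  ?linearN ?linearZ /= ?Px ?Pf ?P2 ?Py ?fk ?linear0 ?scaler0 ?addr0 ?add0r //.
(* The products left are [y, e_2], then [y, x], where (n - 1) g = 0 enters, and [y, y], where the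
   two terms in [t] cancel. *)
- by rewrite scalerN.
- by rewrite scalerA g0 scale0r.
- by rewrite scalerN addNr.
Qed.

Let cf0_Phi_fS m : cf 0 (Phi (f m.+1)) = 0.
Proof.
by have [phi [phi_inj phiM ->]] := Phi_local (f m.+1); exact: aut_cf0_fS.
Qed.

(** * The case where 1, ..., n - 1 are nonzero in K *)

Section LargeCharacteristic.
Hypothesis charK : forall m, (m.+1 < n)%N -> m.+1%:R != 0 :> K.

Let two_neq0 : 2%:R != 0 :> K. Proof. by apply: charK; lia. Qed.

(** An automorphism agreeing with [Phi] at f_0 must itself fix [x], so dividing by it keeps [x]
    fixed. *)
Lemma local_f0_char : Phi x = x -> exists phi,
  [/\ automorphism br phi, phi x = x & Phi (f 0) = phi (f 0)].
Proof.
move=> Px; have [phi [phi_inj phiM Pf0]] := Phi_local (f 0).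
exists phi; split=> //; first exact: inj_morph_automorphism.
apply: aut_x_id_char => //.
set s := cf 0 (phi x); set a := cf 0 (phi (f 0)).
have a0 : a != 0 by exact: aut_cf0_neq0.
apply/eqP; apply: contraT => s0.
(* The f_1-coordinates force the f_0-coordinate of psi (f 0) to vanish. *)
have [psi [psi_inj psiM]] := Phi_local (x + (2%:R * s / a) *: f 0).
rewrite !linearD !linearZ /= Px Pf0 => E.
set r := cf 0 (psi x); set b := cf 0 (psi (f 0)).
have b0 : b != 0 by exact: aut_cf0_neq0.
have := congr1 (cf 0) E; rewrite !linearD !linearZ /= c_basis -/a -/r -/b add0r.
rewrite divfK // => E0.
have := congr1 (cf 1) E; rewrite !linearD !linearZ /= c_basis add0r.
rewrite !aut_f0S //.
rewrite -/a -/s -/r -/b => /(congr1 ( *%R 2%:R)).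
rewrite mulrDr aut_xS //.
rewrite -/r => E1.
(* The f_0-coordinates give (2s/a) b = 2s - r, and twice the f_1-coordinates give - 4s^2 = - r^2 - 2
   (2s - r) r, that is (2s - r)^2 = 0. The factor 2s/a is chosen to complete this square. *)
have : (2%:R * s / a * b) ^+ 2 = 0.
  have Eb : 2%:R * s / a * b = 2%:R * s - r.
    by apply/eqP; rewrite eq_sym subr_eq addrC; apply/eqP.
  have Ea : 2%:R * s / a * - (a * s) = - (2%:R * s * s) by field.
  have Er : 2%:R * s / a * - (b * r) = - ((2%:R * s - r) * r).
    by rewrite -Eb; ring.
  rewrite Eb; move: E1; rewrite Ea Er => E1.
  have -> : (2%:R * s - r) ^+ 2 = - (r * r) + 2%:R * - ((2%:R * s - r) * r)
     + 2%:R * (2%:R * s * s) by ring.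
  by rewrite -E1; ring.
move/eqP; rewrite sqrf_eq0 !mulf_eq0 invr_eq0.
by rewrite (negPf two_neq0) (negPf a0) (negPf b0) (negPf s0).
Qed.

Lemma local_f_char : Phi x = x -> Phi (f 0) = f 0 -> forall m, Phi (f m) = f m.
Proof.
move=> Px Pf0.
(* In [x + f m.+1] the f_0-coordinate forces k_0 = 0, so the automorphism agreeing with [Phi] there
   fixes [x] and scales the chain. *)
have PfS m : exists A, Phi (f m.+1) = A *: f m.+1.
  have [phi [phi_inj phiM]] := Phi_local (x + f m.+1).
  rewrite !linearD /= Px => E.
  have s0 : cf 0 (phi x) = 0.
    have := congr1 (cf 0) E; rewrite !linearD /= c_basis cf0_Phi_fS.
    by rewrite aut_cf0_fS // !addr0.
  have phix : phi x = x by exact: aut_x_id_char.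
  by move: E; rewrite phix => /addrI ->; rewrite aut_f_scale //; eexists.
(* f_1 is treated apart: in f_0 + f_1 its coefficient would mix with k_0 in the f_1-coordinate. *)
case=> [//|[|m]].
  have [A PA] := PfS 0.
  (* With s and a the f_0-coordinates of phi x and phi (f 0), the coefficient
     -1/2 turns the f_1-coordinate of phi of this vector into
     -(s + a)^2 / 2, and s + a = 1. *)
  have [phi [phi_inj phiM]] := Phi_local (x + f 0 - 2%:R^-1 *: f 1).
  rewrite !linearD !linearN !linearZ /= Px Pf0 PA => E.
  have n1 : (1 < n)%N by lia.
  have := congr1 (cf 0) E; rewrite !linearD !linearN !linearZ /= c_basis.
  rewrite aut_cf0_fS // !cf_f //= !mulr0 !subr0 add0r.
  set s := cf 0 _; set a := cf 0 _ => E0.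
  have := congr1 (cf 1) E; rewrite !linearD !linearN !linearZ /= c_basis.
  rewrite aut_cfS_fS // aut_f0S // -/a -/s !cf_f //= mulr1 !add0r.
  move=> /(congr1 ( *%R 2%:R)); rewrite mulrBr mulrDr aut_xS // -/s.
  rewrite mulrN !mulrA divff // !mul1r => E1.
  have A1 : A = (s + a) ^+ 2.
    by rewrite -[A]opprK E1; ring.
  by rewrite A1 -E0 expr1n scale1r.
(* The image of f_(m+2) has no f_0- or f_1-coordinate, so these two coordinates give a = 1 and k_0 =
   0 for [phi]. *)
have [phi [phi_inj phiM]] := Phi_local (f 0 + f m.+2).
rewrite !linearD /= Pf0 => E.
have n1 : (1 < n)%N by lia.
have a1 : cf 0 (phi (f 0)) = 1.
  have := congr1 (cf 0) E; rewrite !linearD /= cf0_Phi_fS cf_f //.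
  by rewrite aut_cf0_fS // !addr0.
have s0 : cf 0 (phi x) = 0.
  have [A PA] := PfS m.+1.
  have := congr1 (cf 1) E; rewrite !linearD PA linearZ /= !cf_f //=.
  rewrite aut_cfS_fS // aut_f0S // aut_cf0_fS // mulr0 !addr0 a1 mul1r.
  by move/eqP; rewrite mulr0 ?addr0 eq_sym oppr_eq0 => /eqP.
have phix : phi x = x by exact: aut_x_id_char.
have phif j : phi (f j) = f j by rewrite aut_f_scale // a1 expr1n scale1r.
by move: E; rewrite !phif => /addrI.
Qed.

End LargeCharacteristic.

(** * The case where k_0 = 0 for every automorphism *)

Section SmallCharacteristic.
Hypothesis aut_s0 : forall phi : {linear L -> L}, injective phi ->
  {morph phi : u v / br u v} -> cf 0 (phi x) = 0.

Let Phi_f_weight j m : cf j (Phi (f m)) != 0 -> j%:R = m%:R :> K.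
Proof.
have [phi [phi_inj phiM ->]] := Phi_local (f m).
by apply: aut_f_weight => //; exact: aut_s0.
Qed.

(** Weights separate the terms of [x + f 0]: [phi x - x] has coordinates only at j with j + 1 = 0 in
    K, while [phi (f 0)] and [Phi (f 0)] have them only at j = 0 in K. *)
Lemma local_f0_weight : Phi x = x -> exists phi,
  [/\ automorphism br phi, phi x = x & Phi (f 0) = phi (f 0)].
Proof.
move=> Px; have [phi [phi_inj phiM]] := Phi_local (x + f 0).
rewrite !linearD /= Px => E.
have phix : phi x = x.
  apply: aut_x_id => // j jn; apply/eqP; apply: contraT => kj.
  have w := aut_x_weight phi_inj phiM (aut_s0 phi_inj phiM) kj.
  have := congr1 (cf j) E; rewrite !linearD /= c_basis add0r.
  have zero z : (cf j z != 0 -> j%:R = 0 :> K) -> cf j z = 0.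
    move=> h; apply/eqP; apply: contraT => /h h0.
    by move: w; rewrite mulrSr h0 add0r => /eqP; rewrite oner_eq0.
  rewrite (zero (Phi (f 0))); last exact: Phi_f_weight.
  rewrite (zero (phi (f 0))); last exact: aut_f_weight (aut_s0 phi_inj phiM).
  by rewrite addr0 => h; rewrite -h eqxx in kj.
exists phi; split=> //; first exact: inj_morph_automorphism.
by move: E; rewrite phix; exact: addrI.
Qed.

Lemma local_f_weight : Phi x = x -> Phi (f 0) = f 0 ->
  forall m, Phi (f m) = f m.
Proof.
move=> Px Pf0 [//|m].
have n1 : (1 < n)%N by lia.
have vanish j (z : L) (i : nat) : (cf j z != 0 -> j%:R = i%:R :> K) ->
    j%:R != i%:R :> K -> cf j z = 0.
  by move=> h; apply: contraNeq => /h ->.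
(* If m + 2 = 0 in K, then f_(m+1) has the same weight as [x], so [x] is left out of the test
   vector; f_0, of weight 1, is still separated from f_(m+1). *)
have [m0|m0] := eqVneq (m.+2%:R : K) 0.
  have [phi [phi_inj phiM]] := Phi_local (f 0 + f m.+1).
  rewrite !linearD /= Pf0 => E.
  have s0 := aut_s0 phi_inj phiM.
  have phi0 : phi (f 0) = f 0.
    have [? ? ?] := aut_coord_f phi_inj phiM 0.
    apply: coord_ext => [j jn|||]; rewrite ?c_basis //.
    have := congr1 (cf j) E; rewrite !linearD /=.
    have [j0|j0] := eqVneq (j%:R : K) 0.
      have jm : j%:R != m.+1%:R :> K.
        move: m0; rewrite j0 mulrSr eq_sym; apply: contra_eq_neq => ->.
        by rewrite add0r oner_neq0.
      rewrite (vanish j (Phi (f m.+1)) m.+1) //; last exact: Phi_f_weight.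
      rewrite (vanish j (phi (f m.+1)) m.+1) //; last exact: aut_f_weight.
      by rewrite !addr0 => <-.
    rewrite (vanish j (phi (f 0)) 0) //; last exact: aut_f_weight.
    by rewrite cf_f //; case: eqP => // j00; rewrite j00 eqxx in j0.
  by move: E; rewrite phi0 (aut_f_id phiM) // => /addrI.
(* Now f_0 and f_(m+1) both have nonzero weight, so the coordinates of weight 0 isolate [phi x], and
   the f_0-coordinate then gives a = 1. *)
have [phi [phi_inj phiM]] := Phi_local (x + f 0 + f m.+1).
rewrite !linearD /= Px Pf0 => E.
have s0 := aut_s0 phi_inj phiM.
have phix : phi x = x.
  apply: aut_x_id => // j jn; have [j1|] := eqVneq (j.+1%:R : K) 0; last first.
    by apply: contraNeq => /(aut_x_weight phi_inj phiM s0) ->.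
  have j0 : j%:R != 0%:R :> K.
    by move: j1; apply: contra_eq_neq; rewrite mulrSr => ->; rewrite add0r oner_neq0.
  have jm : j%:R != m.+1%:R :> K.
    by apply: contra_neq m0 => h; rewrite mulrSr -h -mulrSr.
  have := congr1 (cf j) E; rewrite !linearD /= c_basis add0r cf_f //.
  rewrite (vanish j (phi (f m.+1)) m.+1) //; last exact: aut_f_weight.
  rewrite (vanish j (Phi (f m.+1)) m.+1) //; last exact: Phi_f_weight.
  rewrite (vanish j (phi (f 0)) 0) //; last exact: aut_f_weight.
  rewrite !addr0 => <-; case: eqP => // j00.
  by rewrite j00 eqxx in j0.
have a1 : cf 0 (phi (f 0)) = 1.
  have := congr1 (cf 0) E; rewrite !linearD /= cf0_Phi_fS c_basis cf_f //.
  by rewrite s0 aut_cf0_fS // !addr0 !add0r.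
have phif j : phi (f j) = f j by rewrite aut_f_scale // a1 expr1n scale1r.
by move: E; rewrite phix !phif => /addrI.
Qed.

End SmallCharacteristic.

Lemma char_dichotomy :
  (forall m, (m.+1 < n)%N -> m.+1%:R != 0 :> K) \/
  (forall phi : {linear L -> L}, injective phi ->
  {morph phi : u v / br u v} -> cf 0 (phi x) = 0).
Proof.
have [/forallP h|/forallPn[[m mn] /= m0]] :=
    boolP [forall m : 'I_n.-1, m.+1%:R != 0 :> K].
  by left=> m mn; have mn' : (m < n.-1)%N by [lia]; exact: h (Ordinal mn').
right=> phi phi_inj phiM; apply/eqP; apply: contraNT m0 => /aut_char.
by apply=> //; lia.
Qed.

Lemma local_f0 : Phi x = x -> exists phi,
  [/\ automorphism br phi, phi x = x & Phi (f 0) = phi (f 0)].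
Proof.
by case: char_dichotomy => h; [exact: local_f0_char|exact: local_f0_weight].
Qed.

Lemma local_f : Phi x = x -> Phi (f 0) = f 0 -> forall m, Phi (f m) = f m.
Proof.
by case: char_dichotomy => h; [exact: local_f_char|exact: local_f_weight].
Qed.

End LocalAutomorphism.

End R2Structure.

(** * Normalization at [x] and then at f_0 *)

Unset Implicit Arguments.

Theorem theorem3p3 (K : fieldType) (n : nat) (n_ge3 : (3 <= n)%N)
    (L : vectType K) (br : {bilinear L -> L -> L})
    (e : nat -> L) (x y : L) (R2 : is_R2 br n e x y)
    (Phi : L -> L) (Phi_local : local_automorphism br Phi) :
  automorphism br Phi.
Proof.
(* Bijectivity is automatic: [Phi] is injective and linear in finite dimension. *)
suff PhiM : {morph Phi : u v / br u v}.
  have [g E] := linear_pack Phi_local.1; move: Phi_local PhiM.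
  by rewrite E => /local_automorphism_inj; exact: inj_morph_automorphism.
have [phi [phi_aut Phix]] := Phi_local.2 x.
have [Psi [Psi_local PsiK]] := local_automorphism_div Phi_local phi_aut; apply.
have Psix : Psi x = x.
  by case: phi_aut => _ /bij_inj phi_inj _; apply: phi_inj; rewrite PsiK Phix.
(* [psi] fixes [x], so the second division does not undo the first. *)
have [psi [psi_aut psix Psi0]] := local_f0 n_ge3 R2 Psi_local Psix.
have [Chi [Chi_local ChiK]] := local_automorphism_div Psi_local psi_aut; apply.
have psi_inj : injective psi by case: psi_aut => _ /bij_inj.
have Chix : Chi x = x by apply: psi_inj; rewrite ChiK Psix psix.
have Chi0 : Chi (chain n e 0) = chain n e 0 by apply: psi_inj; rewrite ChiK Psi0.
have Chif := local_f n_ge3 R2 Chi_local Chix Chi0.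
exact: (local_morph_fix n_ge3 R2 Chi_local Chix Chif).
Qed.
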